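(* Let $K$ be a number field and let $g\in K[z]$ be a bicritical polynomial of degree $d\ge 3$ with set of critical points $\{\gamma_1,\gamma_2\}\subseteq K$. Then there exists an element $\phi\in \mathrm{PGL}_2(K)$ (an affine map $\phi(z)=\alpha z+\beta$ with $\alpha,\beta\in K$, $\alpha\ne0$) such that $\phi\circ g\circ\phi^{-1}=a\,\mathcal{B}_{d,k}+c$ for some $k\in\mathbb{N}$ (with $1\le k<d-1$) and some $a,c\in K$.
   Context: Critical points of $g$ are the $\alpha\in\overline K$ with $g'(\alpha)=0$; $g$ is bicritical if it has exactly two distinct critical points. For integers $d\ge 3$ and $1\le k<d-1$, $$\mathcal{B}_{d,k}(z)=\left(\frac{1}{k!}\prod_{j=0}^{k}(d-j)\right)z^{d-k}\sum_{i=0}^{k}\frac{(-1)^i}{d-k+i}\binom{k}{i}z^i,$$ a polynomial of degree $d$ with critical points $0$ and $1$, both fixed, whose derivative is a constant multiple of $z^{d-k-1}(z-1)^k$. *)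

(* Defs.v *)
From HB Require Import structures.
From mathcomp Require Import all_boot all_order all_algebra all_field.
Set Implicit Arguments.
Unset Strict Implicit.
Unset Printing Implicit Defensive.
Import GRing.Theory.
Local Open Scope ring_scope.

Definition is_algebraic_closure (K : fieldType) (Kbar : closedFieldType)
    (iota : {rmorphism K -> Kbar}) : Prop :=
  forall x : Kbar, algebraicOver iota x.

Definition critical_point (K : fieldType) (Kbar : closedFieldType)
    (iota : {rmorphism K -> Kbar}) (g : {poly K}) (x : Kbar) : Prop :=
  root (map_poly iota g)^`() x.

Definition bicritical (K : fieldType) (Kbar : closedFieldType)
    (iota : {rmorphism K -> Kbar}) (g : {poly K}) : Prop :=
  exists x1 x2 : Kbar, x1 != x2 /\
    forall x : Kbar, critical_point iota g x <-> x = x1 \/ x = x2.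

(* The subtractions in nat are exact and the denominators positive when k < d. *)
Definition Bpoly (K : fieldType) (d k : nat) : {poly K} :=
  (k`!%:R^-1 * \prod_(j < k.+1) (d - j)%:R) *:
    ('X^(d - k) *
     \sum_(i < k.+1) ((-1) ^+ i / (d - k + i)%:R * 'C(k, i)%:R) *: 'X^i).

Definition affine (K : fieldType) (alpha beta : K) : {poly K} :=
  alpha *: 'X + beta%:P.

Definition affine_inv (K : fieldType) (alpha beta : K) : {poly K} :=
  affine alpha^-1 (- (beta / alpha)).

Lemma affineK (K : fieldType) (alpha beta : K) : alpha != 0 ->
  affine alpha beta \Po affine_inv alpha beta = 'X /\
  affine_inv alpha beta \Po affine alpha beta = 'X.
Proof.
move=> a0; rewrite /affine_inv /affine.
split; rewrite comp_polyD comp_polyZ comp_polyX comp_polyC scalerDr scalerA.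
  by rewrite mulfV // scale1r -mul_polyC -polyCM mulrN mulrCA mulfV // mulr1
             -addrA -polyCD addNr addr0.
by rewrite mulVf // scale1r -mul_polyC -polyCM mulrC -addrA -polyCD addrN addr0.
Qed.

(* [p \Po q] is p(q(z)), so this is phi o g o phi^-1 for
   phi(z) = alpha z + beta; meaningful when alpha != 0. *)
Definition affine_conj (K : fieldType) (alpha beta : K) (g : {poly K}) :
    {poly K} :=
  affine alpha beta \Po (g \Po affine_inv alpha beta).

(* Main.v *)
Require Import Defs.
From HB Require Import structures.
From mathcomp Require Import all_boot all_order all_algebra all_field.
Import GRing.Theory.
Local Open Scope ring_scope.

(** The derivative of g has exactly the roots gamma1 and gamma2, so it is a
    multiple of (z - gamma1)^m (z - gamma2)^k with m, k > 0 and m + k = d - 1.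
    The affine map sending gamma1 to 0 and gamma2 to 1 turns it into a multiple
    of z^m (z - 1)^k, hence of the derivative of B_{d,k}.  In characteristic 0
    polynomials with equal derivatives differ by a constant. *)

Lemma size_deriv_char0 (F : fieldType) (p : {poly F}) :
  has_pchar0 F -> size p^`() = (size p).-1.
Proof.
move=> /pcharf0P char0; have [->|p0] := eqVneq p 0.
  by rewrite deriv0 size_poly0.
apply/eqP; rewrite eqn_leq -ltnS prednK ?size_poly_gt0 // lt_size_deriv //=.
case def_n: (size p).-1 => [|n] //; rewrite ltnNge.
apply/negP => /leq_sizeP/(_ n (leqnn n)) /eqP.
by rewrite coef_deriv -def_n -lead_coefE -mulr_natr mulf_eq0 lead_coef_eq0
           (negPf p0) char0 def_n.
Qed.

Lemma deriv_eq0_char0 (F : fieldType) (p : {poly F}) :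
  has_pchar0 F -> p^`() = 0 -> p = (p`_0)%:P.
Proof.
move=> char0 dp0; apply: size1_polyC.
by rewrite -subn_eq0 subn1 -(size_deriv_char0 F) // dp0 size_poly0.
Qed.

(** Once the full powers of ['X - a] and ['X - b] are divided out, the cofactor [r] has no root in
    [Fbar], so it is a nonzero constant. *)
Lemma poly_split_two_roots (F : fieldType) (Fbar : closedFieldType)
    (iota : {rmorphism F -> Fbar}) (p : {poly F}) (a b : F) :
    p != 0 ->
    (forall x, root (map_poly iota p) x -> x = iota a \/ x = iota b) ->
  exists2 c : F, c != 0 &
    exists m n : nat, p = c *: (('X - a%:P) ^+ m * ('X - b%:P) ^+ n).
Proof.
move=> p0 rootsp.
have [m [q qa def_p]] := multiplicity_XsubC p a.
have [n [r rb def_q]] := multiplicity_XsubC q b.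
have q0 : q != 0 by apply: contraNneq p0 => q0; rewrite def_p q0 mul0r.
rewrite p0 /= in qa; rewrite q0 /= in rb.
have ra : ~~ root r a.
  by apply: contra qa; rewrite def_q rootM => ->.
have size_r : size r == 1%N.
  rewrite -(size_map_poly iota); apply/negPn/closed_rootP => -[x rx].
  have rpx : root (map_poly iota p) x.
    by rewrite def_p def_q !rmorphM !rootM /= rx.
  by case: (rootsp x rpx) rx => ->; rewrite fmorph_root; apply/negP.
have [c c0 def_r] := size_poly1P r size_r.
exists c => //; exists m, n.
by rewrite def_p def_q def_r -mul_polyC mulrAC mulrA.
Qed.

(** Termwise differentiation cancels the denominators [d - k + i] and leaves the binomial expansion
    of [(1 - 'X) ^+ k]. *)
Lemma deriv_Bpoly (F : fieldType) (d k : nat) :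
    has_pchar0 F -> (k < d)%N ->
  exists2 c : F, c != 0 &
    (Bpoly F d k)^`() = c *: ('X^(d - k.+1) * ('X - 1) ^+ k).
Proof.
move=> /pcharf0P char0 ltkd.
set c0 : F := k`!%:R^-1 * \prod_(j < k.+1) (d - j)%:R.
exists (c0 * (-1) ^+ k).
  rewrite !mulf_neq0 ?signr_eq0 ?invr_eq0 ?char0 -?lt0n ?fact_gt0 //.
  apply/prodf_neq0 => j _; rewrite char0 subn_eq0 -ltnNge.
  exact: leq_trans (ltn_ord j) ltkd.
rewrite /Bpoly -/c0 derivZ -scalerA; congr (_ *: _).
(* The sign [(-1) ^+ k] in the constant turns [('X - 1) ^+ k] into [(1 - 'X) ^+ k]. *)
rewrite scalerAr -exprZn scaleN1r opprB.
rewrite mulr_sumr raddf_sum exprBn mulr_sumr.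
apply: eq_bigr => i _ /=.
rewrite -scalerAr -exprD derivZ derivXn.
have -> : (d - k + i)%N = (d - k.+1 + i).+1 by rewrite -addSn subnSK.
rewrite -scaler_nat scalerA mulrAC mulrVK ?unitfE ?char0 //=.
rewrite expr1n mulr1 -scaler_nat -signr_odd mulr_sign -scalerAr exprD.
rewrite -(signr_odd {poly F}) mulr_sign.
by case: (odd i); rewrite // mulrN scalerN -scaleNr.
Qed.

(** In the chain rule, the outer factor [alpha] cancels the inner factor [alpha^-1]. *)
Lemma deriv_affine_conj (F : fieldType) (alpha beta : F) (g : {poly F}) :
  alpha != 0 ->
  (affine_conj alpha beta g)^`() = g^`() \Po affine_inv alpha beta.
Proof.
move=> alpha0; rewrite /affine_conj /affine_inv /affine.
rewrite !deriv_comp !derivD !derivZ !derivX !derivC !addr0.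
by rewrite !alg_polyC comp_polyC mulrCA -polyCM mulfV // mulr1.
Qed.

Lemma has_pchar0_number_field (K : fieldExtType rat) : has_pchar0 K.
Proof. by move=> p; rewrite pchar_lalg Num.Theory.pchar_num. Qed.

Theorem proposition3p3
  (K : fieldExtType rat)
  (Kbar : closedFieldType) (iota : {rmorphism K -> Kbar})
  (hKbar : is_algebraic_closure iota)
  (d : nat) (hd : (3 <= d)%N)
  (g : {poly K}) (hdeg : size g = d.+1)
  (hbi : bicritical iota g)
  (gamma1 gamma2 : K)
  (hcrit : forall x : Kbar,
     critical_point iota g x <-> x = iota gamma1 \/ x = iota gamma2) :
  exists alpha beta : K, alpha != 0 /\
    exists k : nat, (1 <= k)%N /\ (k < d - 1)%N /\
      exists a c : K,
        affine_conj alpha beta g = a *: Bpoly K d k + c%:P.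
Proof.
have char0K := has_pchar0_number_field K.
have gamma_neq : gamma1 != gamma2.
  apply/eqP => eq_gamma.
  have [x1 [x2 [/eqP neq_x critE]]] := hbi.
  have eq_crit x : x = x1 \/ x = x2 -> x = iota gamma1.
    by move=> /critE /hcrit; rewrite -eq_gamma => -[].
  have x1E := eq_crit x1 (or_introl erefl).
  have x2E := eq_crit x2 (or_intror erefl).
  by case: neq_x; rewrite x1E x2E.
have dg0 : g^`() != 0.
  apply/eqP => /(deriv_eq0_char0 K g char0K) def_g.
  by move: hdeg; rewrite def_g size_polyC; case: eqP hd => //= _; case: d => [|[]].
have crit_root (x : K) : root g^`() x <-> x = gamma1 \/ x = gamma2.
  rewrite -(fmorph_root iota) -deriv_map.
  split=> [/hcrit|].
    by case=> /fmorph_inj ->; [left | right].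
  by move=> x12; apply/hcrit; case: x12 => ->; [left | right].
have [c c0 [m [k def_dg]]] : exists2 c : K, c != 0 &
    exists m n : nat,
      g^`() = c *: (('X - gamma1%:P) ^+ m * ('X - gamma2%:P) ^+ n).
  apply: (poly_split_two_roots _ _ iota) => // x.
  by rewrite -deriv_map => /hcrit.
have m_gt0 : (0 < m)%N.
  have /crit_root : gamma1 = gamma1 \/ gamma1 = gamma2 by left.
  rewrite def_dg rootZ // rootM; case: m {def_dg} => //.
  rewrite expr0 (negPf (root1 _)) /=; case: k => [|k].
    by rewrite expr0 (negPf (root1 _)).
  by rewrite root_exp_XsubC (negPf gamma_neq).
have k_gt0 : (0 < k)%N.
  have /crit_root : gamma2 = gamma1 \/ gamma2 = gamma2 by right.
  rewrite def_dg rootZ // rootM; case: k {def_dg} => //.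
  rewrite expr0 (negPf (root1 _)) orbF; case: m m_gt0 => // m _.
  by rewrite root_exp_XsubC eq_sym (negPf gamma_neq).
(* Both sides of [def_dg] are compared by size: [d] on the left, [(m + k).+1] on the right. *)
have def_d : d = (m + k).+1.
  have /= := congr1 predn hdeg.
  rewrite -(size_deriv_char0 K) // def_dg size_scale //.
  rewrite size_monicM ?monic_exp ?monicXsubC ?expf_neq0 ?polyXsubC_eq0 //.
  by rewrite !size_exp_XsubC addSn addnS.
pose delta := gamma2 - gamma1.
have delta0 : delta != 0 by rewrite subr_eq0 eq_sym.
(* This is z -> (z - gamma1) / (gamma2 - gamma1), with inverse z -> delta z + gamma1. *)
exists delta^-1, (- (gamma1 / delta)); split; first by rewrite invr_eq0.
(* Since [d - 1 = m + k], the strict bound on [k] is [m_gt0]. *)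
exists k; split=> //; split; first by rewrite def_d subn1 /= -add1n leq_add2r.
have ltkd : (k < d)%N by rewrite def_d ltnS leq_addl.
have [b b0 def_dB] := deriv_Bpoly K d k char0K ltkd.
have inv_affine : affine_inv delta^-1 (- (gamma1 / delta))
    = delta *: 'X + gamma1%:P.
  by rewrite /affine_inv /affine invrK mulNr opprK mulfVK.
set h := affine_conj _ _ g.
(* The substitution turns ['X - gamma1] into [delta *: 'X] and ['X - gamma2] into
   [delta *: ('X - 1)]. *)
have dh : h^`() = (c * delta ^+ (m + k)) *: ('X^m * ('X - 1) ^+ k).
  rewrite /h deriv_affine_conj ?invr_eq0 // inv_affine def_dg.
  rewrite comp_polyZ comp_polyM !rmorphXn /= !comp_polyB.
  rewrite !comp_polyX !comp_polyC addrK -addrA -polyCB.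
  rewrite -[gamma1 - _]opprB -/delta polyCN -alg_polyC -scalerBr.
  by rewrite !exprZn -scalerAl -scalerAr !scalerA exprD mulrA.
(* Chosen so that [a *: Bpoly K d k] and [h] have the same derivative; their difference is then its
   own constant coefficient. *)
pose a := c * delta ^+ (m + k) / b.
exists a, (h - a *: Bpoly K d k)`_0.
apply/eqP; rewrite addrC -subr_eq; apply/eqP; apply: deriv_eq0_char0 => //.
rewrite derivB derivZ dh def_dB scalerA mulfVK //.
by rewrite def_d subSS addnK subrr.
Qed.
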